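(* For every integer $l \ge 1$, the resolving independent domination number of the fractal cubic network $FCN(l)$ satisfies $\gamma_{ri}(FCN(l)) = 4\,\gamma_2(FCN(l-1))$, where $\gamma_2$ denotes the 2-domination number.
   Context: Fractal cubic network: for an integer $l\ge 0$, $FCN(l)$ is the finite simple graph whose vertices are all binary strings of length $2l+2$, defined recursively as follows. $FCN(0)$ is the 4-cycle with vertices $00, 01, 11, 10$ in this cyclic order. For $l\ge 1$, $FCN(l)$ is obtained from the disjoint union of the four copies $ab\,\Vert\,FCN(l-1)$, $a,b\in\{0,1\}$ (each vertex string of $FCN(l-1)$ is prefixed by $ab$, adjacency inside a copy being that of $FCN(l-1)$), by adding the four edges $\{00w,10w\}$, $\{10w,11w\}$, $\{11w,01w\}$, $\{01w,00w\}$, where $w=10(01)^{l-1}$ is the string $10$ followed by $l-1$ repetitions of $01$. A set $R\subseteq V(\Gamma)$ of a connected graph $\Gamma$ is a resolving set if for every two distinct vertices $g,h$ there is $r\in R$ with $d(g,r)\ne d(h,r)$ (graph distance). An independent dominating set is a set $D\subseteq V(\Gamma)$ such that every vertex is in $D$ or adjacent to a vertex of $D$, and no two vertices of $D$ are adjacent. A resolving independent dominating set is a set that is both a resolving set and an independent dominating set; $\gamma_{ri}(\Gamma)$ is the minimum size of such a set. A 2-dominating set is a set $D$ such that every $v\in V(\Gamma)\setminus D$ has at least two neighbors in $D$; $\gamma_2(\Gamma)$ is the minimum size of a 2-dominating set. *)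

(* Defs.v *)
From HB Require Import structures.
From mathcomp Require Import all_boot.

Set Implicit Arguments.
Unset Strict Implicit.
Unset Printing Implicit Defensive.

Record sgraph := SGraph {
  vertex :> finType;
  adj : rel vertex;
  adj_sym : symmetric adj;
  adj_irrefl : irreflexive adj }.

Section Graph.
Variable G : sgraph.
Implicit Types (x y : G) (D : {set G}).

Definition walk n x y : bool :=
  [exists p : n.-tuple G, path (@adj G) x p && (last x p == y)].

(* Least length of a walk from x to y. A shortest walk has fewer than #|G|
   edges, so the search range suffices; the value is #|G| exactly when x and y
   are not connected. *)
Definition dist x y : nat := find (fun n => walk n x y) (iota 0 #|G|).

Definition resolving D : bool :=
  [forall g : G, forall h : G,
    (g != h) ==> [exists r in D, dist g r != dist h r]].

Definition dominating D : bool :=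
  [forall v : G, (v \in D) || [exists u in D, adj v u]].

Definition independent D : bool :=
  [forall u in D, forall v in D, ~~ adj u v].

Definition resolving_independent_dominating D : bool :=
  [&& resolving D, independent D & dominating D].

Definition two_dominating D : bool :=
  [forall v : G, (v \notin D) ==> (2 <= #|[set u in D | adj v u]|)].

(* Since #|D| <= #|G| for every D, this is the minimum of #|D| over the D
   satisfying P as soon as there is one; otherwise it is the junk value #|G|. *)
Definition min_card (P : pred {set G}) : nat :=
  \big[minn/#|G|]_(D : {set G} | P D) #|D|.

Definition gamma_ri : nat := min_card resolving_independent_dominating.

(* The whole vertex set is 2-dominating, so the minimum always exists. *)
Definition gamma_2 : nat := min_card two_dominating.

End Graph.

Definition b00 : bitseq := [:: false; false].
Definition b01 : bitseq := [:: false; true].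
Definition b10 : bitseq := [:: true; false].
Definition b11 : bitseq := [:: true; true].

(* The 4-cycle 00, 01, 11, 10; it gives both FCN(0) and the pattern in which
   the four copies are linked in the recursive step. *)
Definition square_adj (u v : bitseq) : bool :=
  let E := [:: (b00, b01); (b01, b11); (b11, b10); (b10, b00)] in
  ((u, v) \in E) || ((v, u) \in E).

(* The string 10(01)^k: linking vertex of FCN(k) in the construction of
   FCN(k+1). *)
Definition link (k : nat) : bitseq := b10 ++ flatten (nseq k b01).

(* Only meaningful on strings of length 2l+2. *)
Fixpoint fcn_adj (l : nat) (u v : bitseq) : bool :=
  if l is k.+1 then
    (take 2 u == take 2 v) && fcn_adj k (drop 2 u) (drop 2 v)
    || [&& square_adj (take 2 u) (take 2 v),
           drop 2 u == link k & drop 2 v == link k]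
  else square_adj u v.

Lemma square_adj_sym : symmetric square_adj.
Proof. by move=> u v; rewrite /square_adj orbC. Qed.

Lemma square_adj_irrefl : irreflexive square_adj.
Proof.
move=> u; rewrite /square_adj orbb; apply/negP; rewrite !inE !xpair_eqE.
by case/or4P=> /andP[/eqP-> ].
Qed.

Lemma fcn_adj_sym l : symmetric (fcn_adj l).
Proof.
elim: l => [|l IHl] u v /=; first exact: square_adj_sym.
by rewrite eq_sym IHl square_adj_sym [(drop 2 u == _) && _]andbC.
Qed.

Lemma fcn_adj_irrefl l : irreflexive (fcn_adj l).
Proof.
elim: l => [|l IHl] u /=; first exact: square_adj_irrefl.
by rewrite IHl square_adj_irrefl andbF.
Qed.

Definition FCN (l : nat) : sgraph :=
  @SGraph ((2 * l + 2).-tuple bool) (fun u v => fcn_adj l u v)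
    (fun u v => fcn_adj_sym l u v) (fun u => fcn_adj_irrefl l u).

(* Main.v *)
Require Import Defs.
From mathcomp Require Import all_boot.
From mathcomp Require Import zify.

Set Implicit Arguments.
Unset Strict Implicit.
Unset Printing Implicit Defensive.

(* The last two bits cut FCN(l) into 4^l squares.  In each square the corners
   00 and 11 have no neighbours outside the square, hence are twins.  A
   resolving set meets every pair of twins, and an independent dominating set
   meeting such a pair contains it; so the set of all corners is the only
   candidate, and it is indeed resolving.  A 2-dominating set also has at least
   two vertices in every square, and the corners form a 2-dominating set.  Thus
   gamma_ri(FCN(l)) = 2 * 4^l for l > 0 and gamma_2(FCN(l)) = 2 * 4^l. *)

Lemma min_card_eq (G : sgraph) (P : pred {set G}) D0 :
  P D0 -> (forall D, P D -> #|D0| <= #|D|) -> min_card P = #|D0|.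
Proof.
move=> PD0 minD0; apply/eqP; rewrite eqn_leq; apply/andP; split.
  rewrite /min_card; have: D0 \in index_enum {set G} by exact: mem_index_enum.
  elim: (index_enum _) => //= D r IH; rewrite inE big_cons => /predU1P[<-|/IH].
    by rewrite PD0 geq_minl.
  by case: ifP => // _ le_r; rewrite geq_min le_r orbT.
(* The default value [#|G|] of the minimum does no harm, being at least [#|D0|]. *)
rewrite /min_card; elim/big_ind: _ => [|m n le_m le_n|D /minD0 //].
  exact: max_card.
by rewrite leq_min le_m.
Qed.

(** * Walks, distances and twins *)

Section Distance.
Variable G : sgraph.
Implicit Types x y z : G.

Lemma walk0 x y : walk 0 x y = (x == y).
Proof.
apply/existsP/idP => [[p]|xy]; first by rewrite tuple0.
by exists [tuple].
Qed.

Lemma walkS n x y : walk n.+1 x y = [exists z, adj x z && walk n z y].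
Proof.
apply/existsP/existsP => [[p]|[z /andP[xz /existsP[p zy]]]].
  case/tupleP: p => z p /= /andP[/andP[xz pz] lastp].
  by exists z; rewrite xz; apply/existsP; exists p; rewrite pz.
by exists (cons_tuple z p); rewrite /= xz.
Qed.

Lemma dist_le_walk n x y : n < #|G| -> walk n x y -> dist x y <= n.
Proof.
move=> ltnG w; rewrite leqNgt; apply/negP => /(before_find 0).
by rewrite nth_iota // w.
Qed.

Lemma walk_dist x y : dist x y < #|G| -> walk (dist x y) x y.
Proof.
rewrite /dist => lt.
have has_w : has (fun n => walk n x y) (iota 0 #|G|).
  by rewrite has_find size_iota.
by have := nth_find 0 has_w; rewrite nth_iota.
Qed.

Lemma dist_xx x : dist x x = 0.
Proof.
apply/eqP; rewrite -leqn0; apply: dist_le_walk; last by rewrite walk0.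
by apply/card_gt0P; exists x.
Qed.

Lemma dist_eq0 x y : dist x y = 0 -> x = y.
Proof.
move=> d0; apply/eqP; rewrite -walk0 -d0; apply: walk_dist.
by rewrite d0; apply/card_gt0P; exists x.
Qed.

Lemma dist_adj x y : 1 < #|G| -> adj x y -> dist x y = 1.
Proof.
move=> G_gt1 xy; apply/eqP; rewrite eqn_leq dist_le_walk //; last first.
  by rewrite walkS; apply/existsP; exists y; rewrite xy walk0 eqxx.
by rewrite lt0n; apply/eqP => /dist_eq0 eq_xy; rewrite eq_xy adj_irrefl in xy.
Qed.

Lemma dist_eq1 x y : 1 < #|G| -> dist x y = 1 -> adj x y.
Proof.
move=> G_gt1 d1; have := @walk_dist x y; rewrite d1 walkS => /(_ G_gt1).
by case/existsP=> z /andP[xz]; rewrite walk0 => /eqP <-.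
Qed.

(** A walk of positive length can have its starting point exchanged for a twin, since only the first
    edge is affected; walks of length 0 are excluded by the two inequalities. *)
Lemma dist_twin x y z : adj x =1 adj y -> z != x -> z != y ->
  dist x z = dist y z.
Proof.
move=> twin zx zy; apply: eq_find => -[|n].
  by rewrite !walk0 eq_sym (negPf zx) eq_sym (negPf zy).
by rewrite !walkS; apply: eq_existsb => t; rewrite twin.
Qed.

Lemma resolving_twin (D : {set G}) x y :
  resolving D -> x != y -> adj x =1 adj y -> (x \in D) || (y \in D).
Proof.
move=> /forallP/(_ x)/forallP/(_ y)/implyP res xy twin.
have /existsP[r /andP[rD /negP dr]] := res xy.
case: (eqVneq r x) => [<-|rx]; first by rewrite rD.
case: (eqVneq r y) => [<-|ry]; first by rewrite rD orbT.
by case: dr; rewrite (dist_twin twin).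
Qed.

End Distance.

(** * Edges inside a square and between squares *)

Lemma square_adjE a b c d :
  square_adj [:: a; b] [:: c; d] = (a == c) (+) (b == d).
Proof. by case: a; case: b; case: c; case: d. Qed.

Lemma linkS k : link k.+1 = link k ++ b01.
Proof.
rewrite /link -catA; congr (_ ++ _).
by elim: k => //= k IH; rewrite {1}IH.
Qed.

Lemma size_link k : size (link k) = 2 * k + 2.
Proof. by elim: k => // k IH; rewrite linkS size_cat IH /=; lia. Qed.

Lemma fcn_adj_square l p a b c d : size p = 2 * l ->
  fcn_adj l (p ++ [:: a; b]) (p ++ [:: c; d]) = (a == c) (+) (b == d).
Proof.
elim: l p => [|l IH] p; first by case: p => //= _; rewrite square_adjE.
case: p => [|e [|f p]] //= sz; first by lia.
by rewrite !drop0 !take0 eqxx square_adj_irrefl orbF IH //; lia.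
Qed.

(** The linking vertex [link k] ends in 10 for k = 0 and in 01 for k > 0. In the latter case the two
    bits before this 01 also belong to [link k], so both ends of the edge share them; they are the
    last two bits of the labels [p] and [q]. *)
Lemma fcn_adj_linked l p q a b c d : size p = 2 * l -> size q = 2 * l ->
    fcn_adj l (p ++ [:: a; b]) (q ++ [:: c; d]) ->
  p = q \/ [/\ a = c, b = d, a != b
             & b -> drop (2 * l - 2) p = drop (2 * l - 2) q].
Proof.
elim: l p q => [|l IH] p q sp sq.
  by left; rewrite (size0nil sp) (size0nil sq).
case: p sp => [|e [|f p]] //= sp; first lia.
case: q sq => [|g [|h q]] //= sq; first lia.
have {}sp : size p = 2 * l by lia.
have {}sq : size q = 2 * l by lia.
rewrite !drop0 !take0; case/orP.
  case/andP=> /eqP[-> ->] /(IH _ _ sp sq)[->|[ac bd ab dr]]; first by left.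
  (* For l = 0 the subtraction truncates, but then the inner labels are empty; otherwise the prefix
     just added lies in the dropped part. *)
  right; split=> // /dr; case: l sp sq {IH dr} => [|l] sp sq.
    by rewrite (size0nil sp) (size0nil sq).
  by have -> : 2 * l.+2 - 2 = (2 * l.+1 - 2).+2 by lia.
case/and3P=> _ /eqP lp /eqP lq; right.
case: l lp lq sp sq {IH} => [|l].
  rewrite /link /=; case: p => [|? p] //; case: q => [|? q] //.
  by move=> [-> ->] [-> ->].
rewrite linkS => /eqP lp /eqP lq sp sq.
have szl : size (link l) = 2 * l.+1 by rewrite size_link mulnSr.
move: lp lq; rewrite !eqseq_cat ?szl //.
move=> /andP[/eqP-> /eqP[-> ->]] /andP[/eqP-> /eqP[-> ->]]; split=> // _.
by have -> : 2 * l.+2 - 2 = (2 * l).+2 by lia.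
Qed.

Lemma fcn_adj_cons l a b u v :
  fcn_adj l u v -> fcn_adj l.+1 [:: a, b & u] [:: a, b & v].
Proof. by move=> /= uv; rewrite !drop0 !take0 eqxx uv. Qed.

(** The innermost linking step joins vertices 10 of squares whose labels differ only in their last
    two bits. Flipping the first of these bits moves one step along that 4-cycle; outer prefixes are
    kept. *)
Lemma fcn_adj_link_ex l p : size p = 2 * l.+1 ->
  exists q, [/\ size q = 2 * l.+1, drop (2 * l) p != drop (2 * l) q
    & fcn_adj l.+1 (p ++ [:: true; false]) (q ++ [:: true; false])].
Proof.
elim: l p => [|l IH] p.
  case: p => [|a [|b []]] // _; exists [:: ~~ a; b]; split => //.
    by case: a.
  by rewrite /= square_adjE; case: a; case: b.
case: p => [|a [|b p]] sp; try by move: sp => /=; lia.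
have /IH[q [sq dq adjq]] : size p = 2 * l.+1 by move: sp => /=; lia.
exists [:: a, b & q]; split; first by rewrite /= sq; lia.
  by have -> : 2 * l.+1 = (2 * l).+2 by lia.
exact: fcn_adj_cons.
Qed.

(** * Vertices as pairs of a square and a position in it *)

Section Cells.
Variable l : nat.
Implicit Types (p q : (2 * l).-tuple bool) (x : FCN l) (D : {set FCN l}).

Definition cell p a b : FCN l := cat_tuple p [tuple a; b].

Lemma cell_surj x : exists p a b, x = cell p a b.
Proof.
have szp : size (take (2 * l) x) == 2 * l.
  by rewrite size_takel // size_tuple; lia.
have szs : size (drop (2 * l) x) = 2.
  by rewrite size_drop size_tuple; lia.
exists (Tuple szp).
have := cat_take_drop (2 * l) x.
case: (drop (2 * l) x) szs => [|a [|b []]] // _ eqx.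
by exists a, b; apply: val_inj.
Qed.

Lemma cell_eq p q a b c d :
  (cell p a b == cell q c d) = [&& p == q, a == c & b == d].
Proof.
rewrite -val_eqE /= eqseq_cat ?size_tuple // -val_eqE.
by rewrite !eqseq_cons andbT.
Qed.

Lemma adj_cell p a b c d :
  adj (cell p a b) (cell p c d) = (a == c) (+) (b == d).
Proof. by rewrite /= fcn_adj_square // size_tuple. Qed.

Lemma adj_cellP p q a b c d : adj (cell p a b) (cell q c d) ->
  p = q \/ [/\ a = c, b = d, a != b
             & b -> drop (2 * l - 2) p = drop (2 * l - 2) q].
Proof.
move=> /fcn_adj_linked; rewrite !size_tuple => /(_ erefl erefl)[].
  by move/val_inj; left.
by right.
Qed.

(** An edge leaving a square starts at a position with two different bits, so corners keep only
    their two neighbours inside the square. The right side does not depend on [a], which makes the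
    two corners of a square twins. *)
Lemma adj_corner p q a c d :
  adj (cell p a a) (cell q c d) = (p == q) && (c != d).
Proof.
case: eqVneq => [<-|pq]; first by rewrite adj_cell; case: a; case: c; case: d.
apply/negP => /adj_cellP[/eqP|[_ _]]; first by rewrite (negPf pq).
by rewrite eqxx.
Qed.

Lemma card_FCN_gt2 : 2 < #|FCN l|.
Proof.
rewrite /= card_tuple card_bool expnD.
by have : 0 < 2 ^ (2 * l); [rewrite expn_gt0 | lia].
Qed.

Lemma card_cells D :
  #|D| = \sum_p \sum_(ab : bool * bool) (cell p ab.1 ab.2 \in D).
Proof.
rewrite -sum1_card pair_big /=.
rewrite (reindex (fun i : _ * (bool * bool) => cell i.1 i.2.1 i.2.2)).
  by rewrite big_mkcond; apply: eq_bigr => i _; case: ifP.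
apply: onW_bij; apply: inj_card_bij => [[p [a b]] [q [c d]]|].
  by move/eqP; rewrite cell_eq /= => /and3P[/eqP-> /eqP-> /eqP->].
by rewrite /= !card_prod !card_tuple card_bool expnD.
Qed.

Lemma cell_sum D p :
  \sum_(ab : bool * bool) (cell p ab.1 ab.2 \in D) =
  (cell p false false \in D) + (cell p true true \in D)
  + ((cell p false true \in D) + (cell p true false \in D)).
Proof.
rewrite -(pair_big xpredT xpredT (fun a b => nat_of_bool (cell p a b \in D))).
by rewrite !big_bool /=; lia.
Qed.

(** Index [2 * l] is the last but one bit of a string of length 2l+2. *)
Definition corners : {set FCN l} :=
  [set x : FCN l | nth false (val x) (2 * l) == last false (val x)].

Lemma cell_corners p a b : (cell p a b \in corners) = (a == b).
Proof. by rewrite inE /= nth_cat size_tuple ltnn subnn /= last_cat. Qed.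

Lemma card_corners : #|corners| = 2 * 4 ^ l.
Proof.
rewrite card_cells (eq_bigr (fun=> 2)) => [|p _].
  by rewrite sum_nat_const card_tuple card_bool expnM mulnC.
by rewrite cell_sum !cell_corners.
Qed.

(** * The 2-domination number *)

Lemma two_dominating_corners : two_dominating corners.
Proof.
apply/forallP => x; apply/implyP; have [p [a [b ->]]] := cell_surj x.
rewrite cell_corners => ab.
have <- : #|[set cell p false false; cell p true true]| = 2.
  by rewrite cards2 cell_eq /= andbF.
apply: subset_leq_card; apply/subsetP => z; rewrite in_set2 in_set.
by case/orP=> /eqP->; rewrite cell_corners eqxx adj_sym adj_corner eqxx ab.
Qed.

Lemma two_dominating_corner D p a : two_dominating D -> cell p a a \notin D ->
  (cell p false true \in D) && (cell p true false \in D).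
Proof.
move=> /forallP/(_ (cell p a a))/implyP dom /dom.
set N := [set _ in _ | _] => le2N; apply/andP.
have eqN : N = [set cell p false true; cell p true false].
  apply/eqP; rewrite eqEcard cards2 cell_eq andbF le2N andbT.
  apply/subsetP => z; rewrite !inE => /andP[_].
  have [q [c [d ->]]] := cell_surj z; rewrite adj_corner => /andP[/eqP<-].
  by rewrite !cell_eq eqxx; case: c; case: d.
have ND z : z \in N -> z \in D by rewrite inE => /andP[].
by rewrite !ND // eqN !inE eqxx ?orbT.
Qed.

Lemma two_dominating_ge D : two_dominating D -> #|corners| <= #|D|.
Proof.
move=> domD; rewrite !card_cells; apply: leq_sum => p _.
rewrite !cell_sum !cell_corners /=.
have dom a := @two_dominating_corner D p a domD.
(* A missing corner forces both vertices 01 and 10 of its square into [D]; if neither is missing,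
   the corners themselves give two vertices. *)
case D0: (cell p false false \in D); last first.
  by have := dom false; rewrite D0 => /(_ isT)/andP[-> ->]; lia.
case D1: (cell p true true \in D); last first.
  by have := dom true; rewrite D1 => /(_ isT)/andP[-> ->]; lia.
by lia.
Qed.

Lemma gamma_2_FCN : gamma_2 (FCN l) = 2 * 4 ^ l.
Proof.
rewrite -card_corners; apply: min_card_eq; first exact: two_dominating_corners.
exact: two_dominating_ge.
Qed.

(** * The resolving independent domination number *)

Lemma independent_corners : independent corners.
Proof.
apply/forall_inP => x; have [p [a [b ->]]] := cell_surj x.
rewrite cell_corners => /eqP->; apply/forall_inP => y.
have [q [c [d ->]]] := cell_surj y.
by rewrite cell_corners adj_corner => ->; rewrite andbF.
Qed.

Lemma dominating_corners : dominating corners.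
Proof.
apply/forallP => x; have [p [a [b ->]]] := cell_surj x.
rewrite cell_corners; case: eqVneq => // ab.
apply/exists_inP; exists (cell p a a); first by rewrite cell_corners.
by rewrite adj_sym adj_corner eqxx ab.
Qed.

Lemma resolving_independent_dominating_sub D :
  resolving_independent_dominating D -> corners \subset D.
Proof.
case/and3P=> resD /forall_inP indD /forallP domD.
apply/subsetP => x; have [p [a [b ->]]] := cell_surj x.
rewrite cell_corners => /eqP->.
have /orP[//|inD] : (cell p b b \in D) || (cell p (~~ b) (~~ b) \in D).
  apply: resolving_twin => // [|y].
    by rewrite cell_eq; case: (b); rewrite andbF.
  by have [q [c [d ->]]] := cell_surj y; rewrite !adj_corner.
(* Here the twin of [cell p b b] is in [D]. A neighbour dominating [cell p b b] would also be
   adjacent to this twin, against independence. *)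
have /orP[//|/exists_inP[y yD]] := domD (cell p b b).
have [q [c [d eqy]]] := cell_surj y; rewrite {}eqy in yD *.
rewrite adj_corner => /andP[/eqP eq_pq cd]; rewrite -{}eq_pq in yD.
have /forall_inP/(_ _ yD) := indD _ inD.
by rewrite adj_corner eqxx cd.
Qed.

(* q is a square linked to p through the vertices 10; the links at p01 lead only
   to squares whose label ends in the same two bits as p, hence not to q. *)
Lemma corner_resolve p : 0 < l -> exists q,
  dist (cell p true false) (cell q false false) !=
  dist (cell p false true) (cell q false false).
Proof.
move=> l_gt0.
have [q [adjq dq]] : exists q, adj (cell p true false) (cell q true false)
    /\ drop (2 * l - 2) p != drop (2 * l - 2) q.
  have := @fcn_adj_link_ex l.-1 p; rewrite (prednK l_gt0) size_tuple.
  case=> // q [/eqP sq dq adjq]; exists (Tuple sq); split=> //.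
  by have -> : 2 * l - 2 = 2 * l.-1 by lia.
have pq : p == q = false by apply/negP => /eqP eqpq; rewrite eqpq eqxx in dq.
exists q; apply/eqP => eqd.
(* The walk goes from 10 in [p] over the link to 10 in [q], then to the corner 00. *)
have le2 : dist (cell p true false) (cell q false false) <= 2.
  apply: dist_le_walk; first exact: card_FCN_gt2.
  rewrite walkS; apply/existsP; exists (cell q true false); rewrite adjq.
  rewrite walkS; apply/existsP; exists (cell q false false).
  by rewrite adj_cell walk0 !eqxx.
have := @walk_dist _ (cell p false true) (cell q false false).
rewrite -{}eqd => /(_ (leq_ltn_trans le2 card_FCN_gt2)).
case: (dist _ _) le2 => [|[|[|]]] // _.
- by rewrite walk0 cell_eq pq.
- rewrite walkS => /existsP[z /andP[+ ]]; rewrite walk0 => /[swap] /eqP->.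
  by rewrite adj_sym adj_corner eq_sym pq.
- rewrite walkS => /existsP[z /andP[adjz ]].
  rewrite walkS => /existsP[z' /andP[+ ]]; rewrite walk0 => /[swap] /eqP->.
  have [r [c [d eqz]]] := cell_surj z; rewrite {}eqz in adjz *.
  rewrite adj_sym adj_corner => /andP[/eqP eqr _]; move: adjz; rewrite -{}eqr.
  (* The middle vertex lies in [q], as the corner has no other neighbours; so 01 in [p] would be
     linked to [q], whose label has different last two bits. *)
  case/adj_cellP=> [/eqP|[_ _ _ /(_ isT)/eqP]]; first by rewrite pq.
  by rewrite (negPf dq).
Qed.

(** A corner is separated from every other vertex by itself, and non-corners of different squares by
    a corner adjacent to just one of them. What remains is 01 against 10 in one square, which needs
    a second square: in FCN(0) both are at distance 1 from both corners. *)
Lemma resolving_corners : 0 < l -> resolving corners.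
Proof.
move=> l_gt0; apply/forallP => g; apply/forallP => h; apply/implyP => gh.
apply/exists_inP.
case gC: (g \in corners).
  exists g => //; rewrite dist_xx eq_sym; apply: contra gh => /eqP.
  by move/dist_eq0 ->.
case hC: (h \in corners).
  exists h => //; rewrite dist_xx; apply: contra gh => /eqP.
  by move/dist_eq0 ->.
have G_gt1 : 1 < #|FCN l| by exact: ltnW card_FCN_gt2.
move: gh gC hC; have [p [a [b ->]]] := cell_surj g.
have [q [c [d ->]]] := cell_surj h.
rewrite cell_eq !cell_corners => gh ab cd.
case: (eqVneq p q) => [eqpq|pq]; last first.
  exists (cell p a a); first by rewrite cell_corners.
  rewrite dist_adj //; last by rewrite adj_sym adj_corner eqxx ab.
  apply/eqP => /esym/dist_eq1 -/(_ G_gt1).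
  by rewrite adj_sym adj_corner (negPf pq).
have [r dr] := corner_resolve p l_gt0.
exists (cell r false false); first by rewrite cell_corners.
move: gh ab cd dr; rewrite -eqpq eqxx.
by case: a; case: b; case: c; case: d => //= _ _ _; rewrite eq_sym.
Qed.

Lemma resolving_independent_dominating_corners :
  0 < l -> resolving_independent_dominating corners.
Proof.
move=> l_gt0; apply/and3P; split; first exact: resolving_corners.
  exact: independent_corners.
exact: dominating_corners.
Qed.

Lemma gamma_ri_FCN : 0 < l -> gamma_ri (FCN l) = 2 * 4 ^ l.
Proof.
move=> l_gt0; rewrite -card_corners; apply: min_card_eq.
  exact: resolving_independent_dominating_corners.
by move=> D /resolving_independent_dominating_sub/subset_leq_card.
Qed.

End Cells.

Theorem corollary2 (l : nat) (hl : 1 <= l) :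
  (exists D : {set FCN l}, resolving_independent_dominating D) /\
  gamma_ri (FCN l) = 4 * gamma_2 (FCN (l - 1)).
Proof.
(* The first conjunct rules out that [gamma_ri] is merely the default value of an empty minimum. *)
split.
  by exists (corners l); exact: resolving_independent_dominating_corners.
by rewrite gamma_ri_FCN // gamma_2_FCN -{1}(subnK hl) addn1 expnS mulnCA.
Qed.
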